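(* Let $G=(V(G),E(G),\ell)$ be a node-labeled graph with $n$ nodes and let $\mathbf{F}\in\mathbb{R}^{n\times p}$ be a node feature matrix consistent with $\ell$. Then for all $t\ge 0$ there exists a parametrization of the Edge Transformer (ET) such that, for all pairs of $2$-tuples $\mathbf{v},\mathbf{w}\in V(G)^2$, $$\mathbf{X}^{(t)}(\mathbf{v})=\mathbf{X}^{(t)}(\mathbf{w})\ \Longrightarrow\ C^{2,\mathrm{F}}_t(\mathbf{v})=C^{2,\mathrm{F}}_t(\mathbf{w}).$$ Here $\mathbf{X}^{(t)}(\mathbf{v})$ is the representation of $\mathbf{v}$ after $t$ ET layers and $C^{2,\mathrm{F}}_t$ is the coloring computed by the folklore $2$-dimensional Weisfeiler--Leman algorithm (2-FWL) after $t$ iterations.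
   Context: Graphs. A node-labeled graph is $G=(V(G),E(G),\ell)$ with $V(G)$ finite (identified with $[n]=\{1,\dots,n\}$, $n=|V(G)|$), undirected edges without self-loops ($(i,j)\in E(G)$ iff $(j,i)\in E(G)$), and labels $\ell:V(G)\to\mathbb{N}$. A matrix $\mathbf{F}\in\mathbb{R}^{n\times p}$ with rows $\mathbf{F}_i$ is consistent with $\ell$ if for all $i,j\in V(G)$: $\mathbf{F}_i=\mathbf{F}_j \iff \ell(i)=\ell(j)$. 2-FWL. The initial coloring $C^{2,\mathrm{F}}_0:V(G)^2\to\mathbb{N}$ satisfies $C^{2,\mathrm{F}}_0(v_1,v_2)=C^{2,\mathrm{F}}_0(w_1,w_2)$ iff $\ell(v_1)=\ell(w_1)$, $\ell(v_2)=\ell(w_2)$, $(v_1=v_2\iff w_1=w_2)$ and $((v_1,v_2)\in E(G)\iff (w_1,w_2)\in E(G))$. For $t>0$, $$C^{2,\mathrm{F}}_t(i,j)=\mathsf{recolor}\big(C^{2,\mathrm{F}}_{t-1}(i,j),\ \{\!\!\{(C^{2,\mathrm{F}}_{t-1}(i,l),C^{2,\mathrm{F}}_{t-1}(l,j)) : l\in V(G)\}\!\!\}\big),$$ where $\{\!\!\{\cdot\}\!\!\}$ denotes a multiset and $\mathsf{recolor}$ maps such pairs injectively to natural numbers not used in previous iterations. Edge Transformer (no positional/structural encodings, no given edge features). All vectors are row vectors. Tokenization: with learnable vectors $\mathbf{x}_1,\mathbf{x}_2\in\mathbb{R}^q$, set $\mathbf{E}_{ij}=\mathbf{x}_1$ if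 $(i,j)\in E(G)$, $\mathbf{E}_{ii}=\mathbf{x}_2$, and $\mathbf{E}_{ij}=\mathbf{0}$ if $i\neq j$ and $(i,j)\notin E(G)$. The input tokens are $\mathbf{X}^{(0)}_{ij}=\phi([\mathbf{E}_{ij}\ \mathbf{F}_i\ \mathbf{F}_j])\in\mathbb{R}^d$, where $\phi:\mathbb{R}^{2p+q}\to\mathbb{R}^d$ is a neural network and $[\cdot]$ is concatenation. The $t$-th layer ($t\ge1$) computes, for all $(i,j)\in V(G)^2$, $$\mathbf{X}^{(t)}_{ij}=\mathsf{FFN}\big(\mathbf{X}^{(t-1)}_{ij}+\mathsf{TriAttention}(\mathsf{LN}(\mathbf{X}^{(t-1)}))_{ij}\big),$$ where $\mathsf{FFN}:\mathbb{R}^d\to\mathbb{R}^d$ is a feed-forward neural network, $\mathsf{LN}$ is layer normalization applied separately to each vector in $\mathbb{R}^d$ ($\mathsf{LN}(x)=\gamma\odot (x-\mathrm{mean}(x))/\sqrt{\mathrm{var}(x)+\varepsilon}+\beta$, with learnable $\gamma,\beta\in\mathbb{R}^d$ and a fixed $\varepsilon>0$), and for $\mathbf{X}\in\mathbb{R}^{n\times n\times d}$, $$\mathsf{TriAttention}(\mathbf{X})_{ij}=\sum_{l=1}^n\alpha_{ilj}\,\mathbf{V}_{ilj},\qquad \mathbf{V}_{ilj}=\mathbf{X}_{il}\mathbf{W}^{V_1}\odot\mathbf{X}_{lj}\mathbf{W}^{V_2},$$ $$\alpha_{ilj}=\frac{\exp(s_{ilj})}{\sum_{l'=1}^n\exp(s_{il'j})},\qquad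 s_{ilj}=\tfrac{1}{\sqrt d}\,\mathbf{X}_{il}\mathbf{W}^Q(\mathbf{X}_{lj}\mathbf{W}^K)^T,$$ with $\odot$ the elementwise product and learnable $\mathbf{W}^Q,\mathbf{W}^K,\mathbf{W}^{V_1},\mathbf{W}^{V_2}\in\mathbb{R}^{d\times d}$. Each layer has its own parameters. For $\mathbf{u}=(i,j)$ write $\mathbf{X}^{(t)}(\mathbf{u})=\mathbf{X}^{(t)}_{ij}$. Neural networks ($\phi$ and $\mathsf{FFN}$) are multilayer perceptrons of arbitrary width and depth with a standard nonlinearity (e.g. ReLU), a class that can approximate every continuous function on a compact set uniformly to arbitrary accuracy. A parametrization of the ET is a choice of $d$, $q$, $\mathbf{x}_1,\mathbf{x}_2$, $\phi$, and all layer parameters; it may depend on $G$ and on $t$. *)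

(* Defs.v *)
From HB Require Import structures.
From mathcomp Require Import all_boot all_order all_algebra.
From mathcomp Require Import finmap multiset.
From mathcomp Require Import all_classical all_reals all_analysis.

Set Implicit Arguments.
Unset Strict Implicit.
Unset Printing Implicit Defensive.

Import Order.TTheory GRing.Theory Num.Theory.
Import numFieldNormedType.Exports.

Local Open Scope classical_set_scope.
Local Open Scope ring_scope.

Record lgraph (n : nat) := LGraph {
  edge : rel 'I_n;
  edge_sym : symmetric edge;
  edge_irr : irreflexive edge;
  label : 'I_n -> nat }.

Definition consistent (R : realType) (n p : nat) (G : lgraph n)
    (F : 'M[R]_(n, p)) : Prop :=
  forall i j, row i F = row j F <-> label G i = label G j.

Definition fwl2_multiset (n : nat) (c : 'I_n * 'I_n -> nat) (u : 'I_n * 'I_n) :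
    {mset (nat * nat)%type}%mset :=
  seq_mset [seq (c (u.1, l), c (l, u.2)) | l <- enum 'I_n].

(* [C t u] is the color of the pair [u] after [t] iterations.  The numbers used
   as colors are not determined by the algorithm, so this is a predicate on the
   sequences of colorings that it may produce.  [recolor] is indexed by the
   iteration because its values must avoid the colors used so far; a single
   injective map is the special case of a constant family. *)
Record is_fwl2 (n : nat) (G : lgraph n) (C : nat -> 'I_n * 'I_n -> nat) : Prop :=
  IsFwl2 {
    fwl2_init : forall v w,
      C 0%N v = C 0%N w <->
      [/\ label G v.1 = label G w.1,
          label G v.2 = label G w.2,
          (v.1 = v.2 <-> w.1 = w.2)
        & (edge G v.1 v.2 <-> edge G w.1 w.2)];
    fwl2_step : exists recolor : nat -> nat * {mset (nat * nat)%type}%mset -> nat,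
      (forall t, injective (recolor t)) /\
      (forall t u, C t.+1 u = recolor t (C t u, fwl2_multiset (C t) u));
    fwl2_fresh : forall s t u w, (s <= t)%N -> C t.+1 u <> C s w }.

(* Multilayer perceptrons with at least one hidden layer, acting on row vectors;
   the activation is applied after every affine map except the last one. *)
Inductive mlp (R : realType) : nat -> nat -> Type :=
  | MlpOne (m h k : nat) (W1 : 'M[R]_(m, h)) (b1 : 'rV[R]_h)
           (W2 : 'M[R]_(h, k)) (b2 : 'rV[R]_k) : mlp R m k
  | MlpCons (m h k : nat) (W : 'M[R]_(m, h)) (b : 'rV[R]_h)
            (N : mlp R h k) : mlp R m k.

Fixpoint mlp_eval (R : realType) (sigma : R -> R) (m k : nat) (N : mlp R m k) :
    'rV[R]_m -> 'rV[R]_k :=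
  match N with
  | MlpOne _ _ _ W1 b1 W2 b2 =>
      fun x => map_mx sigma (x *m W1 + b1) *m W2 + b2
  | MlpCons _ _ _ W b N' =>
      fun x => mlp_eval sigma N' (map_mx sigma (x *m W + b))
  end.

(* [`| _ |] is the sup norm on row vectors. *)
Definition mlp_universal (R : realType) (sigma : R -> R) : Prop :=
  forall (m k : nat) (K : set 'rV[R]_m) (f : 'rV[R]_m -> 'rV[R]_k) (e : R),
    compact K -> {within K, continuous f} -> 0 < e ->
    exists N : mlp R m k, forall x, K x -> `|mlp_eval sigma N x - f x| < e.

Definition hadamard (R : realType) (d : nat) (x y : 'rV[R]_d) : 'rV[R]_d :=
  map2_mx *%R x y.

Definition mean (R : realType) (d : nat) (x : 'rV[R]_d) : R :=
  (\sum_(k < d) x 0 k) / d%:R.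

Definition var (R : realType) (d : nat) (x : 'rV[R]_d) : R :=
  (\sum_(k < d) (x 0 k - mean x) ^+ 2) / d%:R.

Definition layer_norm (R : realType) (eps : R) (d : nat) (gamma beta x : 'rV[R]_d) :
    'rV[R]_d :=
  hadamard gamma ((Num.sqrt (var x + eps))^-1 *: (x - const_mx (mean x))) + beta.

(* The representations of all pairs of nodes: [X i j] is the vector X_ij. *)
Definition tokens (R : realType) (n d : nat) := 'I_n -> 'I_n -> 'rV[R]_d.

Section TriAttention.
Context (R : realType) (n d : nat).
Context (WQ WK WV1 WV2 : 'M[R]_d) (X : tokens R n d).

Definition tri_score (i l j : 'I_n) : R :=
  (Num.sqrt d%:R)^-1 * ((X i l *m WQ) *m (X l j *m WK)^T) 0 0.

Definition tri_alpha (i l j : 'I_n) : R :=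
  expR (tri_score i l j) / \sum_(l' < n) expR (tri_score i l' j).

Definition tri_value (i l j : 'I_n) : 'rV[R]_d :=
  hadamard (X i l *m WV1) (X l j *m WV2).

Definition tri_attention : tokens R n d :=
  fun i j => \sum_(l < n) tri_alpha i l j *: tri_value i l j.
End TriAttention.

Record et_layer (R : realType) (d : nat) := EtLayer {
  l_WQ : 'M[R]_d;
  l_WK : 'M[R]_d;
  l_WV1 : 'M[R]_d;
  l_WV2 : 'M[R]_d;
  l_gamma : 'rV[R]_d;
  l_beta : 'rV[R]_d;
  l_ffn : mlp R d d }.

(* [et_layers P t] holds the parameters of the [t]-th layer, for [1 <= t]; the
   entry at [0] is not used. *)
Record et_param (R : realType) (p : nat) := EtParam {
  et_d : nat;
  et_d_gt0 : (0 < et_d)%N;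
  et_q : nat;
  et_q_gt0 : (0 < et_q)%N;
  et_x1 : 'rV[R]_et_q;
  et_x2 : 'rV[R]_et_q;
  et_phi : mlp R (et_q + p + p) et_d;
  et_layers : nat -> et_layer R et_d }.

Section EdgeTransformer.
Context (R : realType) (sigma : R -> R) (eps : R) (n p : nat).
Context (G : lgraph n) (F : 'M[R]_(n, p)) (P : et_param R p).

Definition et_edge (i j : 'I_n) : 'rV[R]_(et_q P) :=
  if edge G i j then et_x1 P else if i == j then et_x2 P else 0.

Definition et_input : tokens R n (et_d P) := fun i j =>
  mlp_eval sigma (et_phi P) (row_mx (row_mx (et_edge i j) (row i F)) (row j F)).

Definition et_apply_layer (d : nat) (L : et_layer R d) (X : tokens R n d) :
    tokens R n d := fun i j =>
  let Y : tokens R n d :=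
    fun i' j' => layer_norm eps (l_gamma L) (l_beta L) (X i' j') in
  mlp_eval sigma (l_ffn L)
    (X i j + tri_attention (l_WQ L) (l_WK L) (l_WV1 L) (l_WV2 L) Y i j).

Fixpoint et_tokens (t : nat) : tokens R n (et_d P) :=
  if t is t'.+1 then et_apply_layer (et_layers P t) (et_tokens t') else et_input.
End EdgeTransformer.

(* Main.v *)
(** Invariant: after each layer the normalized tokens can be mapped linearly to
    one-hot vectors of classes that refine the 2-FWL colors.  With W^Q = W^K = 0
    the attention is a plain average over [l], and if W^{V_1}, W^{V_2} first read
    off the one-hot vectors, the entry [(a, b)] of the average counts the [l] such
    that [(i, l)] has class [a] and [(l, j)] has class [b]; this is the 2-FWL
    multiset.  A generic rescaling of W^{V_1} makes the residual sum determine
    both of its summands.  The FFN then only has to act on finitely many vectors.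
    It sends them close to distinct unit vectors, and linear independence is an
    open condition, so the exact readout survives the approximation: errors do
    not accumulate over the layers. *)

Require Import Defs.
From HB Require Import structures.
From mathcomp Require Import all_boot all_order all_algebra.
From mathcomp Require Import finmap multiset.
From mathcomp Require Import all_classical all_reals all_analysis.

Set Implicit Arguments.
Unset Strict Implicit.
Unset Printing Implicit Defensive.

Import Order.TTheory GRing.Theory Num.Theory.
Import numFieldNormedType.Exports.

Local Open Scope ring_scope.

(** * Auxiliary facts from topology and linear algebra *)

(** A finite set in an accessible space is discrete; this lets universality be applied to any
    function on finitely many vectors. *)
Lemma finite_within_continuous (T U : topologicalType) (K : set T) (f : T -> U) :
  accessible_space T -> finite_set K -> {within K, continuous f}%classic.
Proof.
move=> /accessible_finite_set_closed clT finK.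
apply/subspace_continuousP => x Kx.
have nbx : nbhs x (~` (K `\` [set x]))%classic.
  apply: open_nbhs_nbhs; split=> [|[_]]; last exact.
  by apply: closed_openC; apply: clT; exact: finite_setD.
move=> A Afx; apply: filterS nbx => y ny Ky /=.
have [<-|neq] := pselect (x = y); first exact: nbhs_singleton.
by case: ny; split=> // yx; exact: neq.
Qed.

(** If [v *m M = 0], each coordinate of [v] is at most [1/(m+1)] times the l1-norm of [v]; summing
    over the [m] coordinates forces that norm to vanish. *)
Lemma near_identity_unitmx (R : realFieldType) (m : nat) (M : 'M[R]_m) :
  (forall i j, `|M i j - (i == j)%:R| < m.+1%:R^-1) -> M \in unitmx.
Proof.
move=> M_near; rewrite -row_free_unit -kermx_eq0; apply/rowV0P => v /sub_kermxP vM0.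
have v_le j : `|v 0 j| <= m.+1%:R^-1 * \sum_i `|v 0 i|.
  have -> : v 0 j = - \sum_i v 0 i * (M i j - (i == j)%:R).
    under eq_bigr do rewrite mulrBr.
    rewrite sumrB [X in X - _](_ : _ = (v *m M) 0 j); last by rewrite mxE.
    rewrite vM0 mxE sub0r opprK (bigD1 j) //= eqxx mulr1 big1 ?addr0 // => i.
    by move=> /negPf ->; rewrite mulr0.
  rewrite normrN mulr_sumr; apply: le_trans (ler_norm_sum _ _ _) _.
  by apply: ler_sum => i _; rewrite normrM mulrC ler_wpM2r // ltW.
have : \sum_j `|v 0 j| <= m%:R * (m.+1%:R^-1 * \sum_i `|v 0 i|).
  apply: le_trans (ler_sum _ (fun j _ => v_le j)) _.
  by rewrite sumr_const card_ord mulr_natl.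
set s := \sum_i _ => s_le.
have s0 : s = 0.
  apply/eqP; rewrite eq_le sumr_ge0 // andbT.
  move: s_le; rewrite mulrCA ler_pdivlMl ?ltr0Sn// -natr1 mulrDl mul1r.
  by rewrite gerDl.
apply/rowP => j; rewrite mxE; apply/eqP; rewrite -normr_eq0.
by apply/eqP; apply: (psumr_eq0P _ s0).
Qed.

(** Each coordinate where [g] separates two points excludes a single scale, so a large enough [s]
    avoids them all. *)
Lemma injective_perturbation (R : realFieldType) (U : finType) (d : nat)
    (f g : U -> 'rV[R]_d) :
  exists s, forall u w, f u + s *: g u = f w + s *: g w -> f u = f w /\ g u = g w.
Proof.
pose r (u w : U) k := (f w 0 k - f u 0 k) / (g u 0 k - g w 0 k).
(* [r u w k] is the only scale that can identify [u] and [w] at coordinate [k]. *)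
exists (1 + \sum_u \sum_w \sum_k `|r u w k|); set s := 1 + _ => u w eq_uw.
have guw : g u = g w.
  apply/rowP => k; apply/eqP; apply: contraT; rewrite -subr_eq0 => gk.
  have sE : s = r u w k.
    apply: (mulIf gk); rewrite divfK //.
    have := congr1 (fun x : 'rV_d => x 0 k) eq_uw; rewrite !mxE => e.
    apply/eqP; rewrite mulrBr subr_eq addrAC eq_sym subr_eq -e addrC eqxx //.
  suff : s <= s - 1 by rewrite lerDl oppr_ge0 ler10.
  rewrite {1}sE /s addrC addKr (le_trans (ler_norm _)) //.
  rewrite (bigD1 u) //= (bigD1 w) //= (bigD1 k) //= -!addrA lerDl.
  by rewrite !addr_ge0 ?sumr_ge0 // => i _; rewrite ?sumr_ge0 // => j _; rewrite sumr_ge0.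
by split => //; move: eq_uw; rewrite guw => /addIr.
Qed.

Lemma row_coord_le_norm (R : realType) (d : nat) (x : 'rV[R]_d) k : `|x 0 k| <= `|x|.
Proof.
rewrite [leRHS]mx_normrE.
exact: (le_bigmax _ (fun ij : 'I_1 * 'I_d => `|x ij.1 ij.2|) (0, k)).
Qed.

(* A token has a coordinate for each pair of classes, and a blank one; class [a]
   is encoded near the unit vector at [pair_pos a a]. *)
Definition token_dim (m : nat) : nat := #|{: option ('I_m * 'I_m)}|.
Definition pair_pos (m : nat) (a b : 'I_m) : 'I_(token_dim m) := enum_rank (Some (a, b)).
Definition blank_pos (m : nat) : 'I_(token_dim m) := enum_rank None.

(** * Layer normalization and one-hot readouts *)

Lemma token_dim_gt0 (m : nat) : (0 < token_dim m)%N.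
Proof. by rewrite /token_dim card_option. Qed.

Local Notation LN eps := (layer_norm eps (const_mx 1) 0).

Lemma layer_norm_coord (R : realType) (eps : R) (d : nat) (x : 'rV[R]_d) k :
  LN eps x 0 k = (Num.sqrt (var x + eps))^-1 * (x 0 k - mean x).
Proof. by rewrite !mxE mul1r addr0. Qed.

Lemma layer_norm_scale_gt0 (R : realType) (eps : R) (d : nat) (x : 'rV[R]_d) :
  0 < eps -> 0 < (Num.sqrt (var x + eps))^-1.
Proof.
move=> eps_gt0; rewrite invr_gt0 sqrtr_gt0 ltr_wpDl //.
by rewrite divr_ge0 // sumr_ge0 // => k _; rewrite sqr_ge0.
Qed.

Lemma layer_norm_readout (R : realType) (eps : R) (m : nat)
    (x : 'I_m -> 'rV[R]_(token_dim m)) :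
  0 < eps ->
  (forall a, `|x a - delta_mx 0 (pair_pos a a) | < (2 * m.+1)%:R^-1) ->
  exists W : 'M[R]_(token_dim m, m), forall a, LN eps (x a) *m W = delta_mx 0 a.
Proof.
move=> eps_gt0 x_near.
(* Differences with the blank coordinate cancel the mean subtracted by [LN]. *)
pose D : 'M[R]_(token_dim m, m) :=
  \matrix_(k, b) ((k == pair_pos b b)%:R - (k == blank_pos m)%:R).
pose M : 'M[R]_m := \matrix_(a, b) (x a 0 (pair_pos b b) - x a 0 (blank_pos m)).
pose tau a := (Num.sqrt (var (x a) + eps))^-1.
have tau_neq0 a : tau a != 0 by rewrite gt_eqF // layer_norm_scale_gt0.
have LND a : LN eps (x a) *m D = tau a *: row a M.
  apply/rowP => b; rewrite !mxE; under eq_bigr do rewrite [D _ _]mxE mulrBr.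
  have pick1 k0 : \sum_k LN eps (x a) 0 k * (k == k0)%:R = LN eps (x a) 0 k0.
    by rewrite (bigD1 k0) //= eqxx mulr1 big1 ?addr0 // => k /negPf ->; rewrite mulr0.
  by rewrite sumrB !pick1 !layer_norm_coord -mulrBr opprB addrA subrK.
have M_unit : M \in unitmx.
  apply: near_identity_unitmx => a b.
  have near k : `|x a 0 k - (k == pair_pos a a)%:R| < (2 * m.+1)%:R^-1.
    apply: le_lt_trans (x_near a); apply: le_trans (row_coord_le_norm _ k).
    by rewrite !mxE eqxx.
  (* Each of the two coordinates is off by less than half of [1/(m+1)], the tolerance of
     [near_identity_unitmx]. *)
  have := ltrD (near (pair_pos b b)) (near (blank_pos m)).
  rewrite natrM invfM mulrC -splitr; apply: le_lt_trans.
  apply: le_trans (ler_normB _ _); rewrite mxE.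
  have -> : (pair_pos b b == pair_pos a a) = (a == b).
    by rewrite (inj_eq enum_rank_inj) [LHS]xpair_eqE andbb eq_sym.
  have -> : (blank_pos m == pair_pos a a) = false by rewrite (inj_eq enum_rank_inj).
  by rewrite subr0 addrAC.
(* Once [invmx M] has turned row [a] into [tau a] times a unit vector, a diagonal matrix on the
   right can cancel this token-dependent scale. *)
exists (D *m invmx M *m diag_mx (\row_a (tau a)^-1)) => a.
rewrite !mulmxA LND -!scalemxAl -row_mul mulmxV // -row_mul mul1mx row_diag_mx.
by rewrite mxE scalerA mulfV // scale1r.
Qed.

Lemma mlp_one_hot (R : realType) (sigma : R -> R) (eps : R) (U : finType) (k : nat)
    (Y : U -> 'rV[R]_k) :
  mlp_universal sigma -> 0 < eps ->
  exists (N : mlp R k (token_dim #|U|)) W (c : U -> 'I_#|U|),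
    (forall u, LN eps (mlp_eval sigma N (Y u)) *m W = delta_mx 0 (c u)) /\
    (forall u w, c u = c w -> Y u = Y w).
Proof.
move=> sigma_universal eps_gt0.
(* One preimage is fixed for each value of [Y], so that the class of [u] depends on [Y u] alone and
   [f] is a function of the value. *)
pose rep y := [pick w | Y w == y].
pose target a : 'rV[R]_(token_dim #|U|) := delta_mx 0 (pair_pos a a).
pose f y := if rep y is Some w then target (enum_rank w) else 0.
pose c u := enum_rank (odflt u (rep (Y u))).
have repP u : exists2 w, rep (Y u) = Some w & Y w = Y u.
  by rewrite /rep; case: pickP => [w /eqP|/(_ u)]; [exists w | rewrite eqxx].
have fY u : f (Y u) = target (c u).
  by rewrite /f /c; have [w -> _] := repP u.
have c_inj u w : c u = c w -> Y u = Y w.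
  rewrite /c => /enum_rank_inj.
  by have [u' -> <-] := repP u; have [w' -> <-] := repP w => /= ->.
have finK : finite_set (range Y) by apply: finite_image; exact: finite_finset.
have [|||N N_near] := sigma_universal _ _ (range Y) f (2 * #|U|.+1)%:R^-1.
- exact: finite_compact.
- apply: finite_within_continuous => //.
  exact/hausdorff_accessible/norm_hausdorff.
- by rewrite invr_gt0 ltr0n.
(* Classes that no [u] takes get the exact target, since the readout lemma asks for a vector in
   every class. *)
pose x a := if [pick u | c u == a] is Some u then mlp_eval sigma N (Y u) else target a.
have xc u : x (c u) = mlp_eval sigma N (Y u).
  by rewrite /x; case: pickP => [w /eqP/c_inj ->|/(_ u)] //; rewrite eqxx.
have [|W WP] := @layer_norm_readout _ eps _ x eps_gt0; last first.
  by exists N, W, c; split=> // u; rewrite -xc WP.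
move=> a; rewrite /x; case: pickP => [u /eqP <-|_].
  by rewrite -/(target _) -fY; apply: N_near; exists u.
by rewrite subrr normr0 invr_gt0 ltr0n.
Qed.

Lemma counting_attention (R : realType) (eps : R) (n m : nat)
    (X : tokens R n (token_dim m)) (c : 'I_n * 'I_n -> 'I_m) W :
  (forall u, LN eps (X u.1 u.2) *m W = delta_mx 0 (c u)) ->
  exists WV1 WV2,
    let Y i j :=
      X i j + tri_attention 0 0 WV1 WV2 (fun i j => LN eps (X i j)) i j in
    forall u w, Y u.1 u.2 = Y w.1 w.2 ->
    X u.1 u.2 = X w.1 w.2 /\
    perm_eq [seq (c (u.1, l), c (l, u.2)) | l <- enum 'I_n]
            [seq (c (w.1, l), c (l, w.2)) | l <- enum 'I_n].
Proof.
move=> WP.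
(* [P1] copies entry [a] to all coordinates [(a, b)] and [P2] copies entry [b]; the Hadamard product
   of two one-hot vectors then marks their pair of classes. *)
pose P1 : 'M[R]_(m, token_dim m) :=
  \matrix_(a, k) (if enum_val k is Some q then (q.1 == a)%:R else 0).
pose P2 : 'M[R]_(m, token_dim m) :=
  \matrix_(a, k) (if enum_val k is Some q then (q.2 == a)%:R else 0).
pose g (u : 'I_n * 'I_n) :=
  tri_attention 0 0 (W *m P1) (W *m P2) (fun i j => LN eps (X i j)) u.1 u.2.
have [s sP] := injective_perturbation (fun u : 'I_n * 'I_n => X u.1 u.2) g.
(* The attention is linear in its first value matrix, which can therefore absorb the scale [s]. *)
exists (s *: (W *m P1)), (W *m P2) => Y u w.
have YE v : Y v.1 v.2 = X v.1 v.2 + s *: g v.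
  congr (_ + _); rewrite /g /tri_attention scaler_sumr; apply: eq_bigr => l _.
  rewrite scalerA [s * _]mulrC -[RHS]scalerA; congr (_ *: _).
  by apply/rowP => k; rewrite /tri_value -scalemxAr !mxE mulrA.
have gE v a b : g v 0 (pair_pos a b) =
    n%:R^-1 * (count_mem (a, b) [seq (c (v.1, l), c (l, v.2)) | l <- enum 'I_n])%:R.
  rewrite /g /tri_attention summxE -sum1_count big_map /=.
  rewrite natr_sum mulr_sumr big_enum_cond [RHS]big_mkcond /=; apply: eq_bigr => l _.
  rewrite /tri_value !mulmxA.
  have := WP (v.1, l); have := WP (l, v.2) => /= -> ->; rewrite -!rowE !mxE.
  rewrite !enum_rankK /= -natrM mulnb -xpair_eqE eq_sym.
  rewrite -mulrb mulr1 -[RHS]mulr_natr; congr (_ * _).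
  have sc l' : expR (tri_score 0 0 (fun i j => LN eps (X i j)) v.1 l' v.2) = 1.
    by rewrite /tri_score mulmx0 mul0mx mxE mulr0 expR0.
  rewrite /tri_alpha sc; under eq_bigr do rewrite sc.
  by rewrite sumr_const card_ord mul1r.
rewrite !YE => /sP[-> guw]; split=> //; apply/allP => -[a b] _ /=.
have := congr1 (fun y : 'rV_(token_dim m) => y 0 (pair_pos a b)) guw; rewrite !gE.
(* The factor [1/n] cancels: [n] is positive because [u.1] inhabits ['I_n]. *)
move=> /mulfI; rewrite invr_eq0 pnatr_eq0 -lt0n (leq_trans _ (ltn_ord u.1)) //.
by move=> /(_ isT) /eqP; rewrite eqr_nat.
Qed.

(** * The invariant and the induction over the layers *)

Section Refinement.
Context (R : realType) (sigma : R -> R) (eps : R) (n p : nat).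
Context (G : lgraph n) (F : 'M[R]_(n, p)).

Local Notation m := #|{: 'I_n * 'I_n}|.

(** A linear readout is demanded because the next attention sees the normalized tokens only through
    its weight matrices. *)
Definition refines (X : tokens R n (token_dim m)) (C : 'I_n * 'I_n -> nat) : Prop :=
  exists W (c : 'I_n * 'I_n -> 'I_m),
    (forall u, LN eps (X u.1 u.2) *m W = delta_mx 0 (c u)) /\
    (forall u w, c u = c w -> C u = C w).

Lemma refinesP X C v w :
  refines X C -> X v.1 v.2 = X w.1 w.2 -> C v = C w.
Proof.
move=> [W [c [WP cC]]] Xvw; apply: cC.
have := WP v; rewrite Xvw WP => /rowP/(_ (c v)); rewrite !mxE !eqxx /=.
by case: eqP => // _ /eqP; rewrite eq_sym oner_eq0.
Qed.

Lemma refines_fwl2 (C : nat -> 'I_n * 'I_n -> nat) t X :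
  mlp_universal sigma -> 0 < eps -> is_fwl2 G C -> refines X (C t) ->
  exists L, refines (et_apply_layer sigma eps L X) (C t.+1).
Proof.
move=> sigma_universal eps_gt0 [_ [recolor [_ Cstep]] _] XC.
have [W [c [WP cC]]] := XC.
have [WV1 [WV2 /= YP]] := counting_attention WP.
pose Y (u : 'I_n * 'I_n) := X u.1 u.2 +
  tri_attention 0 0 WV1 WV2 (fun i j => LN eps (X i j)) u.1 u.2.
have [N [W' [c' [WP' cY]]]] := mlp_one_hot Y sigma_universal eps_gt0.
exists (EtLayer 0 0 WV1 WV2 (const_mx 1) 0 N), W', c'; split=> [[i j]|u w /cY].
  exact: WP'.
move=> /YP[/(refinesP XC) Cuw c_perm]; rewrite !Cstep Cuw; congr (recolor _ (_, _)).
(* [h] sends a class to its 2-FWL color, with default 0 on classes not taken; it carries the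
   multiset of class pairs to that of color pairs. *)
pose h a := if [pick u | c u == a] is Some u then C t u else 0%N.
have hc v : h (c v) = C t v.
  by rewrite /h; case: pickP => [v' /eqP/cC //|/(_ v)]; rewrite eqxx.
apply/eq_seq_msetP; have := perm_map (fun q => (h q.1, h q.2)) c_perm.
by rewrite -!map_comp; congr (perm_eq _ _); apply: eq_map => l /=; rewrite !hc.
Qed.

(** With [q = 1], the scalars 1, 2 and 0 tell edges, diagonal pairs and the remaining pairs
    apart. *)
Definition et_of (phi : mlp R (1 + p + p) (token_dim m))
    (Ls : nat -> et_layer R (token_dim m)) : et_param R p :=
  EtParam (token_dim_gt0 _) (ltn0Sn 0) (const_mx 1) (const_mx 2) phi Ls.

(** Layer [t.+1] can thus be chosen after the first [t] layers without disturbing their tokens. *)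
Lemma et_tokens_eq_layers phi Ls Ls' t :
  (forall s, (0 < s <= t)%N -> Ls s = Ls' s) ->
  et_tokens sigma eps G F (et_of phi Ls) t = et_tokens sigma eps G F (et_of phi Ls') t.
Proof.
elim: t => //= t IH eqL; rewrite eqL ?leqnn // IH // => s /andP[s0 st].
by rewrite eqL // s0 leqW.
Qed.

Lemma refines_init (C : nat -> 'I_n * 'I_n -> nat) Ls :
  mlp_universal sigma -> 0 < eps -> consistent G F -> is_fwl2 G C ->
  exists phi, refines (et_tokens sigma eps G F (et_of phi Ls) 0) (C 0%N).
Proof.
move=> sigma_universal eps_gt0 F_consistent [Cinit _ _].
pose E (u : 'I_n * 'I_n) : 'rV[R]_1 :=
  if edge G u.1 u.2 then const_mx 1 else if u.1 == u.2 then const_mx 2 else 0.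
have edgeE u : edge G u.1 u.2 = (E u 0 0 == 1).
  rewrite /E; case: edge; first by rewrite mxE eqxx.
  by case: ifP => _; rewrite mxE ?(eqr_nat R 2 1) // eq_sym oner_eq0.
have diagE u : (u.1 == u.2) = (E u 0 0 == 2).
  rewrite /E; case: eqVneq => [->|_]; first by rewrite edge_irr mxE eqxx.
  by case: edge; rewrite mxE ?(eqr_nat R 1 2) // eq_sym pnatr_eq0.
pose Y u := row_mx (row_mx (E u) (row u.1 F)) (row u.2 F).
have [phi [W [c [WP cY]]]] := mlp_one_hot Y sigma_universal eps_gt0.
exists phi, W, c; split=> [[i j]|v w /cY /eq_row_mx[/eq_row_mx[Evw]]]; first exact: WP.
move=> /F_consistent lab1 /F_consistent lab2; apply/Cinit; split=> //.
  have dvw : (v.1 == v.2) = (w.1 == w.2) by rewrite !diagE Evw.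
  by split=> /eqP; [rewrite dvw | rewrite -dvw] => /eqP.
by rewrite !edgeE Evw.
Qed.

Lemma refines_all (C : nat -> 'I_n * 'I_n -> nat) :
  mlp_universal sigma -> 0 < eps -> consistent G F -> is_fwl2 G C ->
  forall t, exists phi Ls, refines (et_tokens sigma eps G F (et_of phi Ls) t) (C t).
Proof.
move=> sigma_universal eps_gt0 F_consistent C_fwl2; elim=> [|t [phi [Ls XC]]].
  pose Ls (_ : nat) : et_layer R (token_dim m) := EtLayer 0 0 0 0 0 0 (MlpOne (h := 0) 0 0 0 0).
  by have [phi] := refines_init Ls sigma_universal eps_gt0 F_consistent C_fwl2; exists phi, Ls.
have [L LC] := refines_fwl2 sigma_universal eps_gt0 C_fwl2 XC.
exists phi, (fun s => if s == t.+1 then L else Ls s) => /=; rewrite eqxx.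
rewrite (@et_tokens_eq_layers _ _ Ls) // => s /andP[_ st].
by rewrite ltn_eqF.
Qed.
End Refinement.

Theorem proposition7 (R : realType)
    (sigma : R -> R) (sigma_universal : mlp_universal sigma)
    (eps : R) (eps_gt0 : 0 < eps)
    (n p : nat) (G : lgraph n)
    (F : 'M[R]_(n, p)) (F_consistent : consistent G F)
    (C : nat -> 'I_n * 'I_n -> nat) (C_fwl2 : is_fwl2 G C) :
  forall t : nat, exists P : et_param R p,
    forall v w : 'I_n * 'I_n,
      et_tokens sigma eps G F P t v.1 v.2 = et_tokens sigma eps G F P t w.1 w.2 ->
      C t v = C t w.
Proof.
move=> t.
have [phi [Ls XC]] := refines_all sigma_universal eps_gt0 F_consistent C_fwl2 t.
by exists (et_of phi Ls) => v w; apply: refinesP XC.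
Qed.
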